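(* Let $d\ge3$ be an integer and let $V_1,\dots,V_d$ be fixed unitary matrices in $M_{d-1}(\mathbf{C})$. For $t\in\mathbf{R}$ and $m=1,\dots,d$ let $$A_m=A_m(t)=S^{-m+1}\begin{pmatrix}t&0\\0&V_m\end{pmatrix}S^{m-1}\in M_d(\mathbf{C}).$$ Then either $\{A_m^*A_n\}_{m,n=1}^d$ is linearly dependent for all $t\in\mathbf{R}$, or it is linearly independent except for a finite number of values of $t\in(-1,1)$. The same holds for $\{A_mA_n^*\}_{m,n=1}^d$.
   Context: $\{e_1,\dots,e_d\}$ is the standard basis of $\mathbf{C}^d$ and $S=\sum_{k=1}^d|e_k\rangle\langle e_{k+1}|$ (indices mod $d$) is the cyclic shift. Linear (in)dependence of $\{A_m^*A_n\}_{m,n}$ refers to the family of $d^2$ matrices indexed by pairs $(m,n)$. *)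

(* Defs.v *)
From mathcomp Require Import all_boot all_order all_algebra.
From mathcomp Require Import reals.
From mathcomp Require Import complex.

Set Implicit Arguments.
Unset Strict Implicit.
Unset Printing Implicit Defensive.

Import Order.TTheory GRing.Theory Num.Theory.

Local Open Scope ring_scope.
Local Open Scope complex_scope.
Local Open Scope sesquilinear_scope.

(* The dimension is d = n.+1, so that 'M_d is a unit ring and V_m lives in
   'M_n; the 1-based index m of the source is the ordinal i = m - 1. *)

Section Family.
Variables (R : realType) (n : nat).

(* [ordS] is the successor modulo n.+1. *)
Definition shift_mx : 'M[R[i]]_n.+1 := \sum_k delta_mx k (ordS k).

(* [S ^- i] is [(S ^+ i)^-1], a genuine inverse since S is a permutation
   matrix. *)
Definition twisted_mx (V : 'I_n.+1 -> 'M[R[i]]_n) (t : R) (i : 'I_n.+1) :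
    'M[R[i]]_n.+1 :=
  shift_mx ^- i * (block_mx (t%:C)%:M 0 0 (V i) : 'M_(1 + n)) * shift_mx ^+ i.

Definition adj_mul_family (A : 'I_n.+1 -> 'M[R[i]]_n.+1) : seq 'M[R[i]]_n.+1 :=
  [seq (A k)^t* *m A l | k <- enum 'I_n.+1, l <- enum 'I_n.+1].

Definition mul_adj_family (A : 'I_n.+1 -> 'M[R[i]]_n.+1) : seq 'M[R[i]]_n.+1 :=
  [seq A k *m (A l)^t* | k <- enum 'I_n.+1, l <- enum 'I_n.+1].

End Family.

(* Main.v *)
(** The matrices [(A_k)^* A_l] and [A_k (A_l)^*] have entries polynomial in [t].
    If such a family is free at some [t0], its coordinate functionals at [t0]
    evaluated on the family at [t] form a square matrix whose determinant is a
    polynomial in [t], equal to 1 at [t0], and nonzero only where the family is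
    free; so the family fails to be free at most at its finitely many roots. *)

Require Import Defs.
From mathcomp Require Import all_boot all_order all_algebra.
From mathcomp Require Import boolp classical_sets cardinality reals.
From mathcomp Require Import complex.

Import Order.TTheory GRing.Theory Num.Theory.

Local Open Scope ring_scope.
Local Open Scope classical_set_scope.

Section PolynomialFamilies.
Variable F : fieldType.

(** A linear functional is a fixed combination of the entries, with weights its values on the
    [delta_mx i j]; [p] is that combination of the polynomial entries. *)
Lemma matrix_functional_horner (m n : nat)
    (phi : {linear 'M[F]_(m, n) -> F^o}) (P : 'M[{poly F}]_(m, n)) :
  exists p : {poly F}, forall t, phi (map_mx (horner_eval t) P) = p.[t].
Proof.
exists (\sum_i \sum_j P i j * (phi (delta_mx i j))%:P) => t.
rewrite [X in phi X]matrix_sum_delta linear_sum horner_sum.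
apply: eq_bigr => i _; rewrite linear_sum horner_sum.
apply: eq_bigr => j _; rewrite linearZ mxE /= /horner_eval.
by rewrite hornerM hornerC.
Qed.

(** Applying each [coord Y j] to a linear relation on [X] puts its coefficient row in the left
    kernel of an invertible matrix. *)
Lemma det_coord_neq0_free (vT : vectType F) (N : nat) (X Y : N.-tuple vT) :
  \det (\matrix_(i, j) coord Y j X`_i) != 0 -> free X.
Proof.
move=> detN0; apply/freeP => k kX i.
set M := (\matrix_(_, _) _) in detN0.
have Mu : M \in unitmx by rewrite unitmxE unitfE.
have kM : (\row_i k i) *m M = 0.
  apply/rowP => j; rewrite !mxE.
  transitivity (coord Y j (\sum_(l < N) k l *: X`_l)); last by rewrite kX linear0.
  by rewrite linear_sum; apply: eq_bigr => l _; rewrite linearZ !mxE.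
have := mulmxK Mu (\row_i k i).
by rewrite kM mul0mx => /rowP/(_ i); rewrite !mxE.
Qed.

Lemma not_free_horner_root (m n : nat) (s : seq 'M[{poly F}]_(m, n)) (t0 : F) :
  free [seq map_mx (horner_eval t0) P | P <- s] ->
  exists2 q : {poly F}, q != 0 &
    forall t, ~~ free [seq map_mx (horner_eval t) P | P <- s] -> root q t.
Proof.
(* Fixing the length as [size s] for every [t] makes the coordinate matrix square. *)
pose X t := [tuple of [seq map_mx (horner_eval t) P | P <- in_tuple s]].
have XE t (i : 'I_(size s)) : (X t)`_i = map_mx (horner_eval t) s`_i.
  by rewrite (nth_map 0).
rewrite -/(tval (X t0)) => free0.
have [p pE] : {p | forall (i j : 'I_(size s)) t, coord (X t0) j (X t)`_i = (p i j).[t]}.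
  apply: constructive_indefinite_description.
  have H (i j : 'I_(size s)) : {q : {poly F} | forall t, coord (X t0) j (X t)`_i = q.[t]}.
    apply: cid; have [q qE] := matrix_functional_horner _ _ (coord (X t0) j) s`_i.
    by exists q => t; rewrite XE qE.
  by exists (fun i j => sval (H i j)) => i j; apply: svalP (H i j).
have detE t : (\det (\matrix_(i, j) p i j)).[t] =
    \det (\matrix_(i, j) coord (X t0) j (X t)`_i).
  rewrite -[LHS]/(horner_eval t _) -det_map_mx; congr (\det _).
  by apply/matrixP => i j; rewrite !mxE pE.
exists (\det (\matrix_(i, j) p i j)) => [|t].
  apply/eqP => /(congr1 (fun q => q.[t0])); rewrite detE horner0.
  (* A free family is dual to its own coordinate functionals. *)
  have -> : \matrix_(i, j) coord (X t0) j (X t0)`_i = 1%:M.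
    by apply/matrixP => i j; rewrite !mxE coord_free // eq_sym.
  by rewrite det1 => /eqP; rewrite oner_eq0.
by apply: contraR; rewrite rootE detE; apply: det_coord_neq0_free.
Qed.

End PolynomialFamilies.

(* Conjugating the coefficients conjugates the values because [t] is real. *)
Lemma horner_adjoint (R : rcfType) (m n : nat) (P : 'M[{poly R[i]}]_(m, n))
    (t : R) :
  map_mx (horner_eval (real_complex R t)) (map_mx (map_poly Num.conj) P^T) =
  (map_mx (horner_eval (real_complex R t)) P) ^t*%sesqui.
Proof.
apply/matrixP => i j; rewrite !mxE /horner_eval.
by rewrite -[X in _.[X]](_ : Num.conj (real_complex R t) = _) ?horner_map //;
  apply: conjc_real.
Qed.

(** Over the closed field [R[i]], [q] splits with a finite list of roots; the embedding of [R] is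
    injective, so the preimage of that list is finite. *)
Lemma finite_real_roots (R : rcfType) (q : {poly R[i]}) :
  q != 0 -> finite_set [set t : R | root q (real_complex R t)].
Proof.
move=> qN0; have [r qE] := closed_field_poly_normal q.
apply: (@sub_finite_set _ _ (real_complex R @^-1` [set` r])) => [t /=|].
  by rewrite qE rootZ ?lead_coef_eq0 // root_prod_XsubC.
apply: finite_preimage; last exact: finite_seq.
by move=> x y _ _ /complexI.
Qed.

Lemma dependent_or_finite (R : rcfType) (m n : nat)
    (s : seq 'M[{poly R[i]}]_(m, n)) (X : R -> seq 'M[R[i]]_(m, n)) :
  (forall t, X t = [seq map_mx (horner_eval (real_complex R t)) P | P <- s]) ->
  (forall t, ~~ free (X t)) \/
  finite_set [set t : R | -1 < t < 1 /\ ~~ free (X t)].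
Proof.
move=> XE; have [[t0]|noX] := pselect (exists t, free (X t)); last first.
  by left => t; apply/negP => Xt; apply: noX; exists t.
rewrite XE => /not_free_horner_root[q qN0 q_root]; right.
(* The point [t0] may lie outside the interval: the exceptional set is finite on all of [R], hence
   on [(-1, 1)]. *)
apply: sub_finite_set (finite_real_roots _ _ qN0) => t /= [_].
by rewrite XE => /q_root.
Qed.

(** [twisted_mx] with [t] made an indeterminate. The inverse is taken over [R[i]] before embedding,
    so evaluation need not commute with inversion. *)
Definition twisted_poly (R : realType) (n : nat) (V : 'I_n.+1 -> 'M[R[i]]_n)
    (k : 'I_n.+1) : 'M[{poly R[i]}]_n.+1 :=
  map_mx polyC (shift_mx R n ^- k) *m
  (block_mx 'X%:M 0 0 (map_mx polyC (V k)) : 'M_(1 + n)) *m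
  map_mx polyC (shift_mx R n ^+ k).

Lemma horner_mapC (F : comNzRingType) (m n : nat) (M : 'M[F]_(m, n)) (x : F) :
  map_mx (horner_eval x) (map_mx polyC M) = M.
Proof. by apply/matrixP => i j; rewrite !mxE /horner_eval hornerC. Qed.

Lemma horner_block_mx (F : comNzRingType) (n : nat) (M : 'M[F]_n) (x : F) :
  map_mx (horner_eval x) (block_mx 'X%:M 0 0 (map_mx polyC M) : 'M_(1 + n)) =
  block_mx x%:M 0 0 M.
Proof.
rewrite map_block_mx horner_mapC !map_mx0 map_scalar_mx.
by rewrite /= /horner_eval hornerX.
Qed.

Lemma horner_twisted_poly (R : realType) (n : nat) (V : 'I_n.+1 -> 'M[R[i]]_n)
    (t : R) (k : 'I_n.+1) :
  map_mx (horner_eval (real_complex R t)) (twisted_poly R n V k) =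
  twisted_mx V t k.
Proof.
rewrite /twisted_poly !map_mxM !horner_mapC /twisted_mx -!mulmxE.
congr (_ *m _ *m _); exact: horner_block_mx.
Qed.

Theorem theorem3p5 (R : realType) (n : nat) (d_ge3 : (3 <= n.+1)%N)
    (V : 'I_n.+1 -> 'M[R[i]]_n)
    (V_unitary : forall m : 'I_n.+1, V m \is unitarymx) :
  ((forall t : R, ~~ free (adj_mul_family (twisted_mx V t))) \/
   finite_set [set t : R | -1 < t < 1 /\
                           ~~ free (adj_mul_family (twisted_mx V t))]) /\
  ((forall t : R, ~~ free (mul_adj_family (twisted_mx V t))) \/
   finite_set [set t : R | -1 < t < 1 /\
                           ~~ free (mul_adj_family (twisted_mx V t))]).
Proof.
split.
  (* Transposing and conjugating only the coefficients gives a polynomial matrix that evaluates to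
     the adjoint at real [t]. *)
  apply: (@dependent_or_finite R _ _
    [seq map_mx (map_poly Num.conj) (twisted_poly R n V k)^T *m
         twisted_poly R n V l | k <- enum 'I_n.+1, l <- enum 'I_n.+1]) => t.
  rewrite map_allpairs; apply: eq_allpairs => k l.
  by rewrite map_mxM horner_adjoint !horner_twisted_poly.
apply: (@dependent_or_finite R _ _
  [seq twisted_poly R n V k *m
       map_mx (map_poly Num.conj) (twisted_poly R n V l)^T
    | k <- enum 'I_n.+1, l <- enum 'I_n.+1]) => t.
rewrite map_allpairs; apply: eq_allpairs => k l.
by rewrite map_mxM horner_adjoint !horner_twisted_poly.
Qed.
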